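(* Let $a$ and $b$ be two free random variables in a non-commutative probability space $(\mathcal{A},\varphi)$, with free cumulants $(\kappa_n(a))_{n\ge1}$ and $(\kappa_n(b))_{n\ge1}$, and let $(\kappa_n(ab+ba))_{n\ge1}$ be the free cumulants of $ab+ba$. Then, for every $n\ge 1$, $$\kappa_n(ab+ba)=\sum_{\substack{\pi\in\mathcal{X}_{2n}\\ \pi=\pi'\sqcup\pi''}}\Bigg(\prod_{V\in\pi'}\kappa_{|V|}(a)\prod_{W\in\pi''}\kappa_{|W|}(b)+\prod_{V\in\pi'}\kappa_{|V|}(b)\prod_{W\in\pi''}\kappa_{|W|}(a)\Bigg),$$ where $\pi=\pi'\sqcup\pi''$ is the bipartite decomposition of $\pi$.
   Context: A non-commutative probability space $(\mathcal{A},\varphi)$ is a unital algebra over $\mathbb{C}$ with a linear functional $\varphi$, $\varphi(1)=1$. The free cumulants are the multilinear functionals $\kappa_n:\mathcal{A}^n\to\mathbb{C}$ determined recursively by $\varphi(a_1\cdots a_n)=\sum_{\pi\in\mathcal{NC}(n)}\prod_{V\in\pi}\kappa_{|V|}(a_V)$, where for $V=\{v_1<\dots<v_k\}$, $\kappa_{|V|}(a_V)=\kappa_k(a_{v_1},\dots,a_{v_k})$; $\kappa_n(a):=\kappa_n(a,\dots,a)$. Freeness is free independence, equivalently vanishing of mixed free cumulants: $\kappa_n(a_1,\dots,a_n)=0$ whenever $n\ge2$ and $a_1,\dots,a_n\in\{a,b\}$ are not all equal. $\mathcal{NC}(2n)$ is the set of non-crossing partitions of $[2n]=\{1,\dots,2n\}$.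 For $\pi\in\mathcal{NC}(2n)$, the undirected graph $\mathcal{G}_\pi$ (loops and multiple edges allowed) has as vertices the blocks of $\pi$, and for each $k=1,\dots,n$ one edge joining the block containing $2k-1$ and the block containing $2k$. $\mathcal{X}_{2n}:=\{\pi\in\mathcal{NC}(2n): \mathcal{G}_\pi\text{ is connected and bipartite}\}$. For $\pi\in\mathcal{X}_{2n}$ let $V_1$ be the block containing $1$; the bipartite decomposition $\pi=\pi'\sqcup\pi''$ is defined by letting $\pi'$ be the set of blocks at even distance from $V_1$ in $\mathcal{G}_\pi$, and $\pi''$ the set of blocks at odd distance from $V_1$. *)

(* Defs.v *)
From mathcomp Require Import all_boot all_order all_algebra.
From mathcomp Require Import reals complex.

Set Implicit Arguments.
Unset Strict Implicit.
Unset Printing Implicit Defensive.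

Import Order.TTheory GRing.Theory Num.Theory.

Local Open Scope ring_scope.

(* The set [n] = {1, ..., n} is represented by 'I_n = {0, ..., n - 1}. *)

Definition noncrossing (n : nat) (P : {set {set 'I_n}}) : bool :=
  [forall V in P, forall W in P, forall i in V, forall j in W,
   forall k in V, forall l in W, [&& (i < j)%N, (j < k)%N & (k < l)%N] ==>
   (V == W)].

Definition NC (n : nat) : {set {set {set 'I_n}}} :=
  [set P | partition P [set: 'I_n] && noncrossing P].

Section FreeCumulants.

Variables (K : comNzRingType) (A : algType K) (phi : {scalar A}).

(* [enum V] lists V in increasing order, so this is (s_{v_1}, ..., s_{v_k})   *)
(* for V = {v_1 < ... < v_k}.                                                 *)
Definition restr_seq (s : seq A) (V : {set 'I_(size s)}) : seq A :=
  [seq s`_(val i) | i <- enum V].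

(* kappa_n(a_1, ..., a_n) is obtained by solving the moment-cumulant formula  *)
(* for the term of the one-block partition. The other terms only involve      *)
(* shorter sequences, so [size s] is enough fuel; see [moment_cumulant].      *)
Fixpoint free_cumulant_rec (m : nat) (s : seq A) : K :=
  if m is m'.+1 then
    phi (\prod_(x <- s) x) -
    \sum_(P in NC (size s) | P != [set [set: 'I_(size s)]])
      \prod_(V in P) free_cumulant_rec m' (restr_seq V)
  else 0.

Definition free_cumulant (s : seq A) : K := free_cumulant_rec (size s) s.

Definition kappa (n : nat) (a : A) : K := free_cumulant (nseq n a).

Lemma size_restr_seq (s : seq A) (V : {set 'I_(size s)}) :
  size (restr_seq V) = #|V|.
Proof. by rewrite size_map cardE. Qed.

Lemma partition_setT_in (T : finType) (P : {set {set T}}) :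
  partition P [set: T] -> [set: T] \in P -> P = [set [set: T]].
Proof.
case/and3P=> _ tP P0 TP; apply/setP=> V; rewrite inE.
apply/idP/eqP=> [VP|->//]; apply/eqP; apply: contraT => VT.
have := trivIsetP tP _ _ VP TP VT; rewrite disjoints_subset setCT subset0.
by move=> /eqP V0; rewrite V0 (negPf P0) in VP.
Qed.

Lemma free_cumulant_recE m (s : seq A) : (0 < size s <= m)%N ->
  free_cumulant_rec m s = free_cumulant s.
Proof.
rewrite /free_cumulant.
elim/ltn_ind: m s => -[|m] IH s /andP[s0 sm]; first by rewrite leqNgt s0 in sm.
case sE : (size s) => [|k]; first by rewrite sE in s0.
rewrite [LHS]/= [RHS]/=; congr (_ - _).
apply: eq_bigr => P /andP[]; rewrite inE => /andP[pP _] P1.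
apply: eq_bigr => V VP.
have V0 : (0 < #|V|)%N.
  by rewrite card_gt0; apply: contraTneq VP => ->; case/and3P: pP.
have VT : (#|V| < size s)%N.
  rewrite -[X in (_ < X)%N]card_ord -cardsT ltn_neqAle subset_leq_card ?andbT //.
  apply: contraNneq P1 => /eqP cV.
  have VE : V = [set: _] by apply/eqP; rewrite eqEcard subsetT leq_eqVlt eq_sym cV.
  by rewrite (partition_setT_in pP) ?eqxx // -VE.
have VS := size_restr_seq V.
have Vk : (#|V| <= k)%N by rewrite -ltnS -sE.
have Vm : (#|V| <= m)%N by rewrite -ltnS (leq_trans VT).
rewrite (IH m) ?VS ?V0 //.
have [km|km] := leqP k m; last first.
  suff : (k < m.+1)%N by rewrite ltnS leqNgt km.
  by rewrite -sE.
by rewrite (IH k) ?VS ?V0 // ltnS.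
Qed.

Lemma moment_cumulant (s : seq A) : (0 < size s)%N ->
  phi (\prod_(x <- s) x) =
    \sum_(P in NC (size s)) \prod_(V in P) free_cumulant (restr_seq V).
Proof.
move=> s0; have sT : [set [set: 'I_(size s)]] \in NC (size s).
  rewrite inE; apply/andP; split.
    rewrite /partition /cover big_set1 eqxx trivIset1 !inE /=.
    by rewrite eq_sym -card_gt0 cardsT card_ord.
  apply/'forall_implyP => V /set1P->; apply/'forall_implyP => W /set1P->.
  by do 4!(apply/'forall_implyP => ? _); rewrite eqxx implybT.
rewrite (bigD1 _ sT) /= big_set1.
have -> : restr_seq [set: 'I_(size s)] = s.
  apply: (@eq_from_nth _ 0); rewrite size_restr_seq cardsT card_ord // => i si.
  rewrite /restr_seq enum_setT -enumT (nth_map (Ordinal si)) ?size_enum_ord //.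
  by rewrite [val _]nth_enum_ord.
rewrite -[free_cumulant s](@free_cumulant_recE (size s).+1) ?s0 ?leqnSn //=.
rewrite -[LHS](subrK (\sum_(P in NC (size s) | P != [set setT])
  \prod_(V in P) free_cumulant (restr_seq V))); congr (_ - _ + _).
apply: eq_bigr => P /andP[]; rewrite inE => /andP[pP _] _.
apply: eq_bigr => V VP; rewrite free_cumulant_recE // size_restr_seq.
rewrite card_gt0 -[X in (_ <= X)%N]card_ord max_card andbT.
by apply: contraTneq VP => ->; case/and3P: pP.
Qed.

(* Free independence of the unital subalgebras generated by a and b, which    *)
(* are {p(a)} and {p(b)}, p ranging over the polynomials. The boolean label   *)
(* tells which subalgebra a letter is taken from, so that the notion is the   *)
(* right one also when these subalgebras are not disjoint (e.g. a = b).       *)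
Definition letter (a b : A) (x : bool * {poly K}) : A :=
  horner_alg (if x.1 then a else b) x.2.

Definition freely_independent (a b : A) : Prop :=
  forall w : seq (bool * {poly K}),
    w != [::] ->
    sorted (fun x y => x.1 != y.1) w ->
    (forall x, x \in w -> phi (letter a b x) = 0) ->
    phi (\prod_(x <- w) letter a b x) = 0.

End FreeCumulants.

(* Length of a shortest e-path from x to y (#|T| if there is no e-path).      *)
Definition dist (T : finType) (e : rel T) (x y : T) : nat :=
  find (fun m => [exists p : m.-tuple T, path e x p && (last x p == y)])
       (iota 0 #|T|).

(* The block of P containing the element of value i (set0 if n <= i).         *)
Definition block_at (n : nat) (P : {set {set 'I_n}}) (i : nat) : {set 'I_n} :=
  if insub i is Some j then pblock P j else set0.

Section PartitionGraph.

Variables (n : nat) (P : {set {set 'I_(2 * n)}}).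

(* The endpoints of the k-th edge; the shift to 'I_(2 * n) turns the pairs    *)
(* (2k - 1, 2k), 1 <= k <= n, into (2k, 2k + 1), 0 <= k < n.                  *)
Definition edge_fst (k : 'I_n) : {set 'I_(2 * n)} := block_at P (2 * k)%N.
Definition edge_snd (k : 'I_n) : {set 'I_(2 * n)} := block_at P (2 * k)%N.+1.

Definition graph_adj : rel {set 'I_(2 * n)} := fun V W =>
  [exists k : 'I_n, ((V == edge_fst k) && (W == edge_snd k)) ||
                    ((V == edge_snd k) && (W == edge_fst k))].

Definition graph_connected : bool :=
  [forall V in P, forall W in P, connect graph_adj V W].

(* S is one of the two sides; in particular there is no loop.                 *)
Definition graph_bipartite : bool :=
  [exists S : {set {set 'I_(2 * n)}},
    [forall k : 'I_n, (edge_fst k \in S) != (edge_snd k \in S)]].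

Definition even_blocks : {set {set 'I_(2 * n)}} :=
  [set V in P | ~~ odd (dist graph_adj (block_at P 0) V)].

Definition odd_blocks : {set {set 'I_(2 * n)}} :=
  [set V in P | odd (dist graph_adj (block_at P 0) V)].

End PartitionGraph.

Definition NC_connected_bipartite (n : nat) : {set {set {set 'I_(2 * n)}}} :=
  [set P in NC (2 * n) | graph_connected P && graph_bipartite P].

(* Main.v *)
Require Import Defs.
From mathcomp Require Import all_boot all_order all_algebra.
From mathcomp Require Import reals complex.

Set Implicit Arguments.
Unset Strict Implicit.
Unset Printing Implicit Defensive.

Import Order.TTheory GRing.Theory Num.Theory.

Local Open Scope ring_scope.

(** The formula is the product formula for free cumulants, combined with the
vanishing of mixed cumulants and a count of colourings.

Expanding the powers of ab + ba gives one word of length 2n in a and b for each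
set E of positions where ab, rather than ba, is chosen. Freeness implies that
the moment of any word in a and b is the sum, over the non-crossing partitions
of its positions, of the products of the cumulants of a and b over the blocks,
a block that contains both letters contributing 0 ([free_moment]). Freeness is
given here by moments, so this is proved by induction on the length. Cut the
word into its maximal runs, centre each run, and expand the vanishing moment of
the centred alternating product: this expresses the moment of the word through
moments of shorter words. The sum over partitions satisfies the same recursion
([sum_centered_eq0]): after merging each run into one point, a non-crossing
partition has either a singleton block or a block with two neighbouring points
([NC_of_singleton_or_adjacent]); centring kills the former, and the latter
carries weight 0 because neighbouring runs have different letters.

When the points of a word are merged by a monotone map q, every non-crossing
partition of the points induces a non-crossing partition of the merged points,
namely its connected components, and is recovered from its restrictions to
these components ([NC_sum_preimset]). With q merging 2k-1 and 2k, this shows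
that the moments of ab + ba are given by the moment-cumulant formula with, in
the role of the n-th cumulant, the sum over the connected partitions of [2n]
and over E; as that formula determines the cumulants ([NC_sum_inj]), this sum is
the n-th cumulant of ab + ba ([kappa_anticommutator_words]).

It remains to fix a connected partition. A set E gives a nonzero product only if
the letters of its word are constant on blocks, and then, the two letters of a
pair being different, the colour classes form a bipartition of the graph of
pairs. By connectedness the colour of a block is determined by the colour of the
first one and the parity of the distance to it, so that exactly two sets E remain
if the graph is bipartite, and none otherwise ([sum_word_colorings]). *)

(** * Sums over non-crossing partitions *)

(** A subset of a disjoint union is the same thing as a family of subsets of the
parts. This is used twice: for choices of letters, and for refinements of a given
partition, which are sets of blocks. *)
Lemma big_subset_distr (K : comNzRingType) (U I : finType) (Q : {set I})
    (B : I -> {set U}) (h : I -> {set U} -> K) :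
    {in Q &, forall i j, i != j -> [disjoint B i & B j]} ->
  \sum_(E in powerset (\bigcup_(i in Q) B i)) \prod_(i in Q) h i (E :&: B i) =
  \prod_(i in Q) \sum_(E in powerset (B i)) h i E.
Proof.
move=> disj; rewrite (big_distr_big_dep set0) /=.
pose split (E : {set U}) := [ffun i => if i \in Q then E :&: B i else set0].
pose glue (f : {ffun I -> {set U}}) := \bigcup_(i in Q) f i.
have splitP E : split E \in pfamily set0 (mem Q) (fun i => powerset (B i)).
  apply/pfamilyP; split=> [|i iQ]; last by rewrite ffunE iQ inE subsetIr.
  by apply/supportP => i niQ; rewrite ffunE (negPf niQ).
rewrite [RHS](reindex_onto split glue) /=; last first.
  move=> f /pfamilyP[/supportP f0 fB]; apply/ffunP => i; rewrite ffunE.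
  case: ifP => iQ; last by rewrite f0 ?iQ.
  apply/setP => x; rewrite inE; apply/andP/idP => [[/bigcupP[j jQ xj] xi]|xi].
    have [->//|ij] := eqVneq i j.
    have := disj _ _ iQ jQ ij; rewrite disjoint_subset => /subsetP/(_ _ xi).
    by rewrite inE; have := fB _ jQ; rewrite inE => /subsetP/(_ _ xj)->.
  split; first by apply/bigcupP; exists i.
  by have := fB _ iQ; rewrite inE => /subsetP->.
have glueK E : glue (split E) = E :&: \bigcup_(i in Q) B i.
  rewrite big_distrr; apply: eq_bigr => i iQ /=; by rewrite ffunE iQ.
apply: eq_big => [E|E _]; first by rewrite splitP glueK inE; apply/setIidPl/eqP.
by apply: eq_bigr => i iQ; rewrite ffunE iQ.
Qed.

(** Partitions of a subset D of [n], rather than of [#|D|], so that blocks and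
restrictions need no renumbering. *)
Definition NC_of (n : nat) (D : {set 'I_n}) : {set {set {set 'I_n}}} :=
  [set P | partition P D && noncrossing P].

Definition NC_sum (K : comNzRingType) (n : nat) (h : {set 'I_n} -> K)
    (D : {set 'I_n}) : K :=
  \sum_(P in NC_of D) \prod_(V in P) h V.

Section Noncrossing.
Variable n : nat.
Implicit Types (P : {set {set 'I_n}}) (D V W : {set 'I_n}).

Lemma noncrossingP P : reflect
  (forall V W (i j k l : 'I_n), V \in P -> W \in P ->
     i \in V -> j \in W -> k \in V -> l \in W ->
     (i < j)%N -> (j < k)%N -> (k < l)%N -> V = W)
  (noncrossing P).
Proof.
apply: (iffP forall_inP) => [nc V W i j k l VP WP iV jW kV lW ij jk kl|nc V VP].
  move: (nc _ VP) => /forall_inP/(_ _ WP)/forall_inP/(_ _ iV)/forall_inP.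
  move=> /(_ _ jW)/forall_inP/(_ _ kV)/forall_inP/(_ _ lW)/implyP.
  by rewrite ij jk kl => /(_ isT)/eqP.
apply/forall_inP => W WP; apply/forall_inP => i iV; apply/forall_inP => j jW.
apply/forall_inP => k kV; apply/forall_inP => l lW; apply/implyP.
by case/and3P=> ij jk kl; apply/eqP; apply: (nc V W i j k l).
Qed.

(** Only the cyclic order of the four points matters for a crossing. *)
Lemma noncrossing_cyclic P V W (i j k l : 'I_n) : noncrossing P ->
  V \in P -> W \in P -> i \in V -> j \in W -> k \in V -> l \in W ->
  (i < j)%N -> (j < k)%N -> (l < i)%N || (k < l)%N -> V = W.
Proof.
move=> /noncrossingP nc VP WP iV jW kV lW ij jk /orP[li|kl].
  by apply/esym; apply: (nc W V l i j k).
exact: (nc V W i j k l).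
Qed.

Lemma NC_of_set1 D : D != set0 -> [set D] \in NC_of D.
Proof.
move=> D0; rewrite inE /partition /cover big_set1 eqxx trivIset1 inE eq_sym D0.
by apply/noncrossingP => V W i j k l /set1P-> /set1P->.
Qed.

Lemma partition_trivial P D : partition P D -> D \in P -> P = [set D].
Proof.
case/and3P=> /eqP cP tP P0 DP; apply/setP=> V; rewrite inE.
apply/idP/eqP => [VP|->//]; apply/eqP; apply: contraT => VD.
have /(_ VD) := trivIsetP tP _ _ VP DP.
have VsD : V \subset D by rewrite -cP; exact: bigcup_sup.
rewrite -setI_eq0 (setIidPl VsD) => /eqP V0.
by rewrite V0 (negPf P0) in VP.
Qed.

Lemma NC_of_proper P D V : P \in NC_of D -> P != [set D] -> V \in P ->
  (V != set0) && (V \proper D).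
Proof.
rewrite inE => /andP[pP _] PD VP; rewrite (partition_neq0 pP VP).
rewrite properEneq (partitionS pP VP) andbT; apply: contraNneq PD => VD.
by apply/eqP/(partition_trivial pP); rewrite -VD.
Qed.

Lemma NC_of0 : NC_of set0 = [set set0 :> {set {set 'I_n}}].
Proof.
apply/setP => P; rewrite !inE partition_set0; case: eqP => //= ->.
by apply/noncrossingP => V W i j k l; rewrite inE.
Qed.

Lemma NC_sum0 (K : comNzRingType) (h : {set 'I_n} -> K) : NC_sum h set0 = 1.
Proof. by rewrite /NC_sum NC_of0 big_set1 big_set0. Qed.

Lemma NC_sum_trivial (K : comNzRingType) (h : {set 'I_n} -> K) D : D != set0 ->
  NC_sum h D =
    h D + \sum_(P in NC_of D | P != [set D]) \prod_(V in P) h V.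
Proof. by move=> D0; rewrite /NC_sum (bigD1 _ (NC_of_set1 D0)) /= big_set1. Qed.

Lemma eq_NC_sum (K : comNzRingType) (g h : {set 'I_n} -> K) D :
    (forall V, V != set0 -> V \subset D -> g V = h V) ->
  NC_sum g D = NC_sum h D.
Proof.
move=> gh; apply: eq_bigr => P; rewrite inE => /andP[pP _].
by apply: eq_bigr => V VP; apply: gh; [apply: partition_neq0 pP VP | apply: partitionS pP VP].
Qed.

(** The moment-cumulant formula is triangular: besides the one-block partition, only
proper subsets of D occur, so the cumulants are determined by the moments. *)
Lemma NC_sum_inj (K : comNzRingType) (g h : {set 'I_n} -> K) :
    (forall D, D != set0 -> NC_sum g D = NC_sum h D) ->
  forall D, D != set0 -> g D = h D.
Proof.
move=> gh D; have [m] := ubnP #|D|; elim: m D => // m IH D Dm D0.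
have := gh D D0; rewrite !NC_sum_trivial //.
rewrite [X in _ + X = _](_ : _ = \sum_(P in NC_of D | P != [set D])
   \prod_(V in P) h V); first by move/addIr.
apply: eq_bigr => P /andP[PD P1]; apply: eq_bigr => V VP.
have /andP[V0 VD] := NC_of_proper PD P1 VP.
by apply: IH => //; apply: leq_trans (proper_card VD) _.
Qed.

End Noncrossing.

Lemma ltn_sorted_enum n (D : {set 'I_n}) : sorted ltn (map val (enum D)).
Proof.
rewrite sorted_map /enum_mem; apply: sorted_filter; first exact: ltn_trans.
by rewrite -enumT -sorted_map val_enum_ord iota_ltn_sorted.
Qed.

(** * Increasing injections *)

Section Transport.
Variables (m n : nat) (f : 'I_m -> 'I_n).
Hypothesis f_mono : {mono f : i j / (i < j)%N}.

Lemma mono_ord_inj : injective f.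
Proof.
move=> i j /eqP; apply: contraTeq; rewrite -!(inj_eq val_inj) !neq_ltn /=.
by rewrite !f_mono.
Qed.

Lemma enum_imset_mono (V : {set 'I_m}) : enum (f @: V) = map f (enum V).
Proof.
apply: (@inj_map _ _ (val : 'I_n -> nat)); first exact: val_inj.
apply: (irr_sorted_eq ltn_trans ltnn); first exact: ltn_sorted_enum.
  rewrite -map_comp sorted_map; have := ltn_sorted_enum V; rewrite sorted_map.
  by apply: sub_sorted => i j; rewrite /= f_mono.
move=> x; apply/mapP/mapP => -[y yV ->].
  move: yV; rewrite mem_enum => /imsetP[z zV ->]; exists (f z) => //.
  by rewrite map_f ?mem_enum.
by case/mapP: yV => z; rewrite mem_enum => zV ->; exists (f z); rewrite ?mem_enum ?imset_f.
Qed.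

Let F (P : {set {set 'I_m}}) : {set {set 'I_n}} := (fun V : {set 'I_m} => f @: V) @: P.

Lemma noncrossing_imset (P : {set {set 'I_m}}) : noncrossing (F P) = noncrossing P.
Proof.
have memF V x : (f x \in f @: (V : {set _})) = (x \in V) := mem_imset _ _ mono_ord_inj.
apply/noncrossingP/noncrossingP => nc.
  move=> V W i j k l VP WP iV jW kV lW ij jk kl.
  apply: (imset_inj mono_ord_inj).
  by apply: (nc _ _ (f i) (f j) (f k) (f l)); rewrite ?memF ?f_mono ?imset_f.
move=> V' W' ? ? ? ? /imsetP[V VP ->] /imsetP[W WP ->].
move=> /imsetP[i iV ->] /imsetP[j jW ->] /imsetP[k kV ->] /imsetP[l lW ->].
by rewrite !f_mono => ij jk kl; rewrite (nc V W i j k l).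
Qed.

Lemma NC_sum_imset (K : comNzRingType) (h : {set 'I_n} -> K) (D : {set 'I_m}) :
  NC_sum h (f @: D) = NC_sum (fun V => h (f @: V)) D.
Proof.
have fI := imset_inj mono_ord_inj.
rewrite /NC_sum (reindex_onto F (fun P : {set {set 'I_n}} => (fun V : {set 'I_n} => f @^-1: V) @: P)) /=.
  apply: eq_big => [P|P _]; last by rewrite big_imset //=; move=> ? ? _ _; exact: fI.
  rewrite !inE /F imset_partition; last exact: mono_ord_inj.
  rewrite -/(F P) noncrossing_imset -imset_comp.
  rewrite [X in _ && (X == P)](_ : _ = P) ?eqxx ?andbT //.
  rewrite -[RHS]imset_id; apply: eq_imset => V /=; apply/setP => x.
  by rewrite inE (mem_imset _ _ mono_ord_inj).
move=> P; rewrite inE => /andP[pP _]; rewrite /F -imset_comp.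
rewrite -[RHS]imset_id; apply: eq_in_imset => V VP /=.
apply/setP => y; apply/imsetP/idP => [[x]|yV]; first by rewrite inE => ? ->.
have /imsetP[x _ yE] := subsetP (partitionS pP VP) _ yV.
by exists x; rewrite ?inE -?yE.
Qed.

End Transport.

(** * Products in increasing order of the indices *)

Section OrderedProducts.
Variable A : pzRingType.

Lemma prod_sorted_cut (I : Type) (s : seq I) (q : I -> nat) (x : I -> A) m :
    sorted (fun i j => q i <= q j)%N s ->
  (\prod_(i <- s | (q i < m)%N) x i) * (\prod_(i <- s | q i == m) x i) =
  \prod_(i <- s | (q i < m.+1)%N) x i.
Proof.
elim: s => [|i s IH]; first by rewrite !big_nil mul1r.
move=> si; have ss := path_sorted si; rewrite !big_cons [(q i < m.+1)%N]ltnS [(q i <= m)%N]leq_eqVlt.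
case: (ltngtP (q i) m) => [qim|qim|qim] /=; [by rewrite -mulrA IH | exact: IH |].
suff P1 : \prod_(j <- s | (q j < m)%N) x j = 1
  by rewrite P1 -IH // P1 !mul1r.
have: all (fun j => q i <= q j)%N s.
  by apply: order_path_min si => a b c; apply: leq_trans.
rewrite qim; elim: (s) => [|j t IHt /= /andP[mj mt]]; first by rewrite big_nil.
by rewrite big_cons ltnNge mj IHt.
Qed.

Lemma prod_sorted_group (I : Type) (s : seq I) k (q : I -> 'I_k) (x : I -> A) :
    sorted (fun i j => q i <= q j)%N s ->
  \prod_(i <- s) x i = \prod_(j < k) \prod_(i <- s | q i == j) x i.
Proof.
move=> ss; under [RHS]eq_bigr do under eq_bigl do rewrite -val_eqE /=.
rewrite -(big_mkord predT (fun j => \prod_(i <- s | q i == j :> nat) x i)).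
have cut m : \prod_(i <- s | (q i < m)%N) x i =
    \prod_(0 <= j < m) \prod_(i <- s | q i == j :> nat) x i.
  elim: m => [|m IH]; first by rewrite big_geq //= big_pred0.
  by rewrite big_nat_recr //= -IH // (@prod_sorted_cut _ _ (fun i => val (q i))).
by rewrite -cut; apply: eq_bigl => i; rewrite ltn_ord.
Qed.

(** As products do not commute, the order of the factors matters: it is the order
of the indices. *)
Lemma prod_enum n (D : {pred 'I_n}) (x : 'I_n -> A) :
  \prod_(i in D) x i = \prod_(i <- enum D) x i.
Proof. by rewrite [index_enum _]unlock /enum_mem big_filter. Qed.

Lemma prod_preimset N k (q : 'I_N -> 'I_k) (x : 'I_N -> A) (X : {set 'I_k}) :
    {homo q : i j / (i <= j)%N} ->
  \prod_(i in q @^-1: X) x i =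
  \prod_(j in X) \prod_(i in q @^-1: [set j]) x i.
Proof.
move=> qm; rewrite prod_enum (@prod_sorted_group _ _ _ q); last first.
  have := ltn_sorted_enum (q @^-1: X); rewrite sorted_map.
  by apply: sub_sorted => i j /ltnW/qm.
rewrite [RHS]big_mkcond; apply: eq_bigr => j _ /=.
rewrite -[LHS]big_filter /enum_mem -filter_predI.
rewrite -[filter _ _]/(enum [pred i | (q i == j) && (i \in q @^-1: X)]) -prod_enum.
case: ifP => jX.
  by apply: eq_bigl => i; rewrite !inE; case: eqP => //= ->; rewrite jX.
by apply: big_pred0 => i; rewrite !inE; case: eqP => //= ->; rewrite jX.
Qed.
End OrderedProducts.

Lemma set_param n (D : {set 'I_n}) m : #|D| = m ->
  exists2 f : 'I_m -> 'I_n, {mono f : i j / (i < j)%N} & f @: setT = D.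
Proof.
case: m => [/cards0_eq->|m mE].
  exists (fun i : 'I_0 => False_rect _ (notF (ltn_ord i))); first by case.
  by apply/setP => x; rewrite inE; apply/imsetP => -[[]].
have [i0 _] : exists i0, i0 \in D by apply/card_gt0P; rewrite mE.
have sE : size (enum D) = m.+1 by rewrite -cardE.
pose f (i : 'I_m.+1) : 'I_n := nth i0 (enum D) i.
have f_homo (i j : 'I_m.+1) : (i < j)%N -> (f i < f j)%N.
  move=> ij; have := sorted_ltn_nth ltn_trans 0%N (ltn_sorted_enum D).
  move=> /(_ i j); rewrite !inE !size_map sE !ltn_ord => /(_ isT isT ij).
  by rewrite !(nth_map i0) ?sE.
exists f.
  move=> i j; case: (ltngtP i j) => [/f_homo->//|/f_homo|/val_inj->].
    by move=> /ltnW; rewrite leqNgt => /negPf.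
  by rewrite ltnn.
apply/setP => x; apply/imsetP/idP => [[i _ ->]|xD].
  by rewrite -mem_enum mem_nth ?sE.
have xs : (index x (enum D) < m.+1)%N by rewrite -sE index_mem mem_enum.
by exists (Ordinal xs); rewrite // /f nth_index ?mem_enum.
Qed.

Lemma prod_imset (A : pzRingType) m n (f : 'I_m -> 'I_n) (x : 'I_n -> A)
    (D : {set 'I_m}) : {mono f : i j / (i < j)%N} ->
  \prod_(i in f @: D) x i = \prod_(i in D) x (f i).
Proof. by move=> fm; rewrite !prod_enum enum_imset_mono // big_map. Qed.

(** * Moments as sums of cumulants *)

Section Moments.
Variables (K : comNzRingType) (A : algType K) (phi : {scalar A}).
Hypothesis phi1 : phi 1 = 1.

(** The moment-cumulant formula, transported from the positions of the sequence of
the w i to the set D itself. The empty set accounts for the hypothesis on phi 1. *)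
Lemma moment_NC_sum n (w : 'I_n -> A) (D : {set 'I_n}) :
  phi (\prod_(i in D) w i) =
  NC_sum (fun V => free_cumulant phi [seq w i | i <- enum V]) D.
Proof.
have [->|D0] := eqVneq D set0; first by rewrite NC_sum0 big_set0.
pose s := [seq w i | i <- enum D].
have sE : #|D| = size s by rewrite size_map cardE.
have [f f_mono fT] := set_param sE.
have s_gt0 : (0 < size s)%N by rewrite -sE card_gt0.
have enumD : enum D = map f (enum 'I_(size s)) by rewrite -fT enum_imset_mono // enum_setT -enumT.
rewrite -[X in NC_sum _ X]fT NC_sum_imset //.
rewrite prod_enum -(big_map w predT idfun) moment_cumulant //.
apply: eq_bigr => P _; apply: eq_bigr => V _; congr free_cumulant.
rewrite enum_imset_mono // -map_comp; apply: eq_map => i /=.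
have nthD (j : nat) x0 : nth x0 (enum D) j = nth x0 (map f (enum 'I_(size s))) j.
  by rewrite -enumD.
by rewrite (nth_map (f i)) -?cardE ?sE // nthD (nth_map i) ?size_enum_ord // nth_ord_enum.
Qed.

End Moments.

(** * Merging points by a monotone map *)

(** A path that leaves U has a first edge that does so. *)
Lemma connect_exit (T : finType) (e : rel T) (U : pred T) x y :
    connect e x y -> U x -> ~~ U y ->
  exists u v, [/\ connect e x u, e u v, U u & ~~ U v].
Proof.
case/connectP=> p + ->; elim: p x => [|z p IH] x /=; first by move=> _ ->.
case/andP=> xz zp Ux Uy; have [Uz|Uz] := boolP (U z).
  have [u [v [zu uv Uu Uv]]] := IH z zp Uz Uy; exists u, v; split=> //.
  exact: connect_trans (connect1 xz) zu.
by exists x, z; rewrite connect0.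
Qed.

Lemma connect_stable (T : finType) (e e' : rel T) (U : pred T) x y :
    (forall u v, U u -> e u v -> e' u v && U v) ->
  U x -> connect e x y -> connect e' x y && U y.
Proof.
move=> ee' + /connectP[p + ->]; elim: p x => [|z p IH] x Ux /=.
  by rewrite connect0 Ux.
case/andP=> xz zp; have /andP[xz' Uz] := ee' _ _ Ux xz.
by have /andP[zy ->] := IH z Uz zp; rewrite (connect_trans (connect1 xz')).
Qed.

Section Grouping.
Variables (N n : nat) (q : 'I_N -> 'I_n).
Hypothesis q_homo : {homo q : i j / (i <= j)%N}.
Implicit Types (P : {set {set 'I_N}}) (D V : {set 'I_n}) (W : {set 'I_N}).

(** After merging, the blocks of P may overlap; the blocks of the partition induced
on the merged points are the classes of the equivalence generated by this relation. *)
Definition touch P : rel 'I_n :=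
  fun k l => [exists W in P, (k \in q @: W) && (l \in q @: W)].

Definition linked V P : bool :=
  [forall k in V, forall l in V, connect (touch P) k l].

Lemma touchP P k l : reflect
  (exists W i j, [/\ W \in P, i \in W, j \in W, q i = k & q j = l]) (touch P k l).
Proof.
apply: (iffP exists_inP) => [[W WP /andP[/imsetP[i iW ->] /imsetP[j jW ->]]]|].
  by exists W, i, j.
move=> [W [i [j [WP iW jW <- <-]]]]; exists W => //.
by rewrite !imset_f.
Qed.

Lemma touch_mem P W i j : W \in P -> i \in W -> j \in W -> touch P (q i) (q j).
Proof. by move=> WP iW jW; apply/touchP; exists W, i, j. Qed.

Lemma touch_sym P : connect_sym (touch P).
Proof.
apply: sym_connect_sym => k l; apply/touchP/touchP => -[W [i [j [? ? ? ? ?]]]];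
by exists W, j, i.
Qed.

Lemma homo_ltn i j : (q i < q j)%N -> (i < j)%N.
Proof. by apply: contraTT; rewrite -!leqNgt; apply: q_homo. Qed.

(** The components of a non-crossing partition do not cross. If they did, the path
from i to k would enter the interval between j and l by one edge, and the path
between j and l would have to leave the span of that edge: the two blocks that
carry these edges cross, unless they are equal and join the two components. *)
Lemma connect_touch_crossing P (i j k l : 'I_n) : noncrossing P ->
    (i < j)%N -> (j < k)%N -> (k < l)%N ->
  connect (touch P) i k -> connect (touch P) j l -> connect (touch P) i j.
Proof.
move=> ncP ij jk kl cik cjl; apply: contraT => nij.
have sep x y : connect (touch P) i x -> connect (touch P) j y -> x != y.
  move=> cix cjy; apply: contraNneq nij => xy.
  by apply: (connect_trans cix); rewrite xy touch_sym.
(* The span of an edge of the component of i cannot separate a from b, if these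
   two points are in the component of j. *)
have span (x y a b : 'I_n) : connect (touch P) i x -> touch P x y ->
    (x < a)%N -> (a < y)%N -> ~~ ((x < b)%N && (b < y)%N) ->
    connect (touch P) j a -> connect (touch P) a b -> False.
  move=> cix xy xa ay nb cja cab.
  have ciy := connect_trans cix (connect1 xy).
  have xay : (x < a)%N && (a < y)%N by rewrite xa ay.
  have [u [v [cau uv /andP[xu uy]]]] :=
    @connect_exit _ _ (fun z : 'I_n => (x < z)%N && (z < y)%N) _ _ cab xay nb.
  have cju := connect_trans cja cau.
  have cjv := connect_trans cju (connect1 uv).
  have := sep _ _ cix cjv; have := sep _ _ ciy cjv.
  rewrite -!(inj_eq val_inj) /= negb_and -!leqNgt => yv xv vout.
  have {}vout : (v < x)%N || (y < v)%N.
    by rewrite ltn_neqAle eq_sym xv /= orbC ltn_neqAle yv /= orbC.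
  have [W [p [r [WP pW rW px ry]]]] := touchP _ _ _ xy.
  have [W' [s [t [WP' sW tW su tv]]]] := touchP _ _ _ uv.
  have WW : W = W'.
    apply: (noncrossing_cyclic ncP WP WP' pW sW rW tW); try by apply: homo_ltn; rewrite ?px ?ry ?su.
    by apply/orP; case/orP: vout => ?; [left|right]; apply: homo_ltn; rewrite ?px ?ry ?tv.
  have : touch P x u by rewrite -px -su; apply: (touch_mem WP) => //; rewrite WW.
  move/connect1/(connect_trans cix) => ciu.
  by have := sep _ _ ciu cju; rewrite eqxx.
have jkl : (j < k)%N && (k < l)%N by rewrite jk kl.
have nij' : ~~ ~~ ((j < k)%N && (k < l)%N) by rewrite jkl.
have iout : ~~ ((j < i)%N && (i < l)%N) by rewrite ltnNge (ltnW ij).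
have [x [y [cix xy]]] :=
  @connect_exit _ _ (fun z : 'I_n => ~~ ((j < z)%N && (z < l)%N)) _ _ cik iout nij'.
rewrite negbK => xout /andP[jy yl].
have := sep _ _ cix (connect0 _ j); have := sep _ _ cix cjl.
rewrite -!(inj_eq val_inj) /= => xl xj.
have [xj'|jx] := ltnP x j.
  case: (span x y j l) => //; by rewrite ?negb_and -?leqNgt ?(ltnW yl) ?orbT ?connect0.
have lx : (l < x)%N.
  rewrite ltn_neqAle eq_sym xl leqNgt /=; apply: contra xout => ->.
  by rewrite ltn_neqAle eq_sym xj jx.
case: (span y x l j) => //.
- exact: connect_trans cix (connect1 xy).
- by case/touchP: xy => W [s [t [? ? ? <- <-]]]; apply: (@touch_mem _ W).
- by rewrite negb_and -leqNgt (ltnW jy).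
- by rewrite touch_sym.
Qed.

Definition joined D P : {set {set 'I_n}} :=
  equivalence_partition (connect (touch P)) D.

Lemma connect_touch_equiv D P : {in D & &, equivalence_rel (connect (touch P))}.
Proof.
move=> x y z _ _ _; rewrite connect0; split=> // xy.
exact: (same_connect (touch_sym P) xy).
Qed.

Lemma joined_NC D P : P \in NC_of (q @^-1: D) -> joined D P \in NC_of D.
Proof.
rewrite !inE => /andP[_ ncP].
have eqv := @connect_touch_equiv D P.
rewrite (equivalence_partitionP eqv) /=.
apply/noncrossingP => _ _ i j k l /imsetP[x xD ->] /imsetP[y yD ->].
rewrite !inE => /andP[iD xi] /andP[jD yj] /andP[kD xk] /andP[lD yl] ij jk kl.
have sym := touch_sym P.
have cij : connect (touch P) i j.
  apply: (connect_touch_crossing ncP ij jk kl).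
    by apply: connect_trans xk; rewrite sym.
  by apply: connect_trans yl; rewrite sym.
have cxy : connect (touch P) x y.
  by apply: (connect_trans xi); apply: (connect_trans cij); rewrite sym.
by apply/setP => z; rewrite !inE (same_connect sym cxy).
Qed.

(** The blocks that lie over V; without the empty set, these families are disjoint
for disjoint V. *)
Definition parts_in V : {set {set 'I_N}} := powerset (q @^-1: V) :\ set0.

Lemma in_parts W V : (W \in parts_in V) = (W != set0) && (W \subset q @^-1: V).
Proof. by rewrite !inE. Qed.

Lemma sub_preimP W V : reflect {in W, forall x, q x \in V} (W \subset q @^-1: V).
Proof.
by apply: (iffP subsetP) => WV x /WV; rewrite inE.
Qed.

Lemma parts_disjoint (D : {set 'I_n}) (Q : {set {set 'I_n}}) : partition Q D ->
  {in Q &, forall V V', V != V' -> [disjoint parts_in V & parts_in V']}.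
Proof.
case/and3P=> _ /trivIsetP tQ _ V V' VQ V'Q VV'.
rewrite disjoint_subset; apply/subsetP => W; rewrite in_parts inE => /andP[W0 WV].
rewrite in_parts W0 /=; have [x xW] := set0Pn _ W0.
apply/negP => WV'; have := tQ _ _ VQ V'Q VV'.
rewrite disjoint_subset => /subsetP/(_ (q x)); rewrite inE.
by move=> /(_ (sub_preimP _ _ WV _ xW)); rewrite (sub_preimP _ _ WV' _ xW).
Qed.

Section Refinement.
Variables (D : {set 'I_n}) (Q : {set {set 'I_n}}) (P : {set {set 'I_N}}).
Hypothesis QD : Q \in NC_of D.

Let pQ : partition Q D. Proof. by move: QD; rewrite inE => /andP[]. Qed.
Let ncQ : noncrossing Q. Proof. by move: QD; rewrite inE => /andP[]. Qed.

Let blockQ V k l : V \in Q -> k \in V -> (l \in pblock Q k) = (l \in V).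
Proof. by move=> VQ kV; rewrite (def_pblock (partition_trivIset pQ) VQ kV). Qed.

Let pblockQ k : k \in D -> (pblock Q k \in Q) && (k \in pblock Q k).
Proof.
by move=> kD; rewrite mem_pblock pblock_mem ?(cover_partition pQ).
Qed.

Lemma joined_restrict : P \in NC_of (q @^-1: D) -> joined D P = Q ->
  P \subset \bigcup_(V in Q) parts_in V /\
  {in Q, forall V, (P :&: parts_in V \in NC_of (q @^-1: V)) &&
                   linked V (P :&: parts_in V)}.
Proof.
rewrite inE => /andP[pP ncP] jQ.
have cQ k l : k \in D -> l \in D -> connect (touch P) k l = (l \in pblock Q k).
  move=> kD lD; rewrite -jQ.
  by rewrite (pblock_equivalence_partition (@connect_touch_equiv D P)).
have qD W x : W \in P -> x \in W -> q x \in D.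
  by move=> WP; apply/sub_preimP/(partitionS pP WP).
have W_parts W V x : W \in P -> V \in Q -> x \in W -> q x \in V -> W \in parts_in V.
  move=> WP VQ xW xV; rewrite in_parts (partition_neq0 pP WP).
  apply/sub_preimP => y yW; rewrite -(blockQ _ VQ xV) -cQ ?(qD W) //.
  exact/connect1/(touch_mem WP).
have VD V : V \in Q -> {subset V <= D} by move=> VQ; apply/subsetP/(partitionS pQ).
split.
  apply/subsetP => W WP; have [x xW] := set0Pn _ (partition_neq0 pP WP).
  have /andP[VQ xV] := pblockQ (qD _ _ WP xW).
  by apply/bigcupP; exists (pblock Q (q x)); rewrite ?(W_parts _ _ x).
move=> V VQ; apply/andP; split.
  rewrite inE; apply/andP; split; last first.
    apply/noncrossingP => W W' i j k l; rewrite !inE => /andP[WP _] /andP[W'P _].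
    by move/noncrossingP: ncP; apply.
  apply/and3P; split.
  - apply/eqP/setP => x; apply/bigcupP/idP => [[W]|].
      by rewrite inE in_parts => /andP[_ /andP[_ /subsetP WV]] /WV.
    rewrite inE => xV.
    have xP : x \in cover P by rewrite (cover_partition pP) inE (VD _ VQ).
    exists (pblock P x); last by rewrite mem_pblock.
    by rewrite inE pblock_mem // (W_parts _ _ x) ?pblock_mem ?mem_pblock.
  - exact: trivIsetS (subsetIl _ _) (partition_trivIset pP).
  - by rewrite inE (partition0 pP).
apply/forall_inP => k kV; apply/forall_inP => l lV.
have ckl : connect (touch P) k l by rewrite cQ ?(VD _ VQ) // (blockQ _ VQ).
have [] // := andP (connect_stable (U := mem V) (e' := touch (P :&: parts_in V)) _ kV ckl).
move=> u v uV /touchP[W [i [j [WP iW jW iu jv]]]].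
have WV : W \in parts_in V by apply: (W_parts _ _ i) => //; rewrite iu.
apply/andP; split; first by apply/touchP; exists W, i, j; rewrite inE WP WV.
by move: WV; rewrite in_parts -jv => /andP[_ /sub_preimP]; apply.
Qed.

(** Non-crossing partitions over the blocks of Q together are non-crossing: a
crossing of blocks over two different blocks of Q would, q being monotone, be a
crossing of these two. *)
Lemma joined_glue : P \subset \bigcup_(V in Q) parts_in V ->
  {in Q, forall V, (P :&: parts_in V \in NC_of (q @^-1: V)) &&
                   linked V (P :&: parts_in V)} ->
  P \in NC_of (q @^-1: D) /\ joined D P = Q.
Proof.
move=> /subsetP PQ good.
have VD V : V \in Q -> {subset V <= D} by move=> VQ; apply/subsetP/(partitionS pQ).
have PV W : W \in P -> exists2 V, V \in Q & W \in P :&: parts_in V.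
  by move=> WP; have /bigcupP[V VQ WV] := PQ _ WP; exists V; rewrite // inE WP.
have goodP V : V \in Q -> partition (P :&: parts_in V) (q @^-1: V).
  by move=> /good/andP[]; rewrite inE => /andP[].
have qV W V x : W \in P :&: parts_in V -> x \in W -> q x \in V.
  by rewrite inE in_parts => /and3P[_ _ /sub_preimP]; apply.
have sameV V V' x : V \in Q -> V' \in Q -> x \in V -> x \in V' -> V = V'.
  move=> VQ V'Q xV xV'; rewrite -(def_pblock (partition_trivIset pQ) VQ xV).
  exact: (def_pblock (partition_trivIset pQ) V'Q xV').
split.
  rewrite inE; apply/andP; split.
    apply/and3P; split.
    - apply/eqP/setP => x; apply/bigcupP/idP => [[W WP xW]|].
        have [V VQ WV] := PV _ WP; rewrite inE.
        by apply: (VD _ VQ); apply: (qV W).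
      rewrite inE => /pblockQ/andP[VQ xV].
      have : x \in cover (P :&: parts_in (pblock Q (q x))).
        by rewrite (cover_partition (goodP _ VQ)) inE.
      by case/bigcupP => W; rewrite inE => /andP[WP _] xW; exists W.
    - apply/trivIsetP => W W' WP W'P WW'.
      have [V VQ WV] := PV _ WP; have [V' V'Q WV'] := PV _ W'P.
      rewrite -setI_eq0; apply: contraT => /set0Pn[x]; rewrite inE => /andP[xW xW'].
      have VV : V = V' by apply: (sameV _ _ (q x)) => //; [apply: qV WV _|apply: qV WV' _].
      rewrite -VV in WV'.
      have /trivIsetP := partition_trivIset (goodP _ VQ).
      move/(_ _ _ WV WV' WW'); rewrite -setI_eq0 => /eqP/setP/(_ x).
      by rewrite !inE xW xW'.
    - apply/negP => /PV[V VQ]; by rewrite inE in_parts eqxx andbF.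
  apply/noncrossingP => W W' i j k l WP W'P iW jW' kW lW' ij jk kl.
  have [V VQ WV] := PV _ WP; have [V' V'Q WV'] := PV _ W'P.
  have VV : V = V'.
    have iV := qV _ _ _ WV iW; have kV := qV _ _ _ WV kW.
    have jV := qV _ _ _ WV' jW'; have lV := qV _ _ _ WV' lW'.
    have := q_homo (ltnW ij); rewrite leq_eqVlt => /orP[/eqP/val_inj qij|qij].
      by apply: (sameV _ _ (q i)); rewrite // qij.
    have := q_homo (ltnW jk); rewrite leq_eqVlt => /orP[/eqP/val_inj qjk|qjk].
      by apply: (sameV _ _ (q k)); rewrite // -qjk.
    have := q_homo (ltnW kl); rewrite leq_eqVlt => /orP[/eqP/val_inj qkl|qkl].
      by apply: (sameV _ _ (q k)); rewrite // qkl.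
    exact: (noncrossingP _ ncQ V V' (q i) (q j) (q k) (q l)).
  rewrite -VV in WV'; have /andP[] := good _ VQ.
  rewrite inE => /andP[_ /noncrossingP nc] _.
  exact: (nc W W' i j k l).
rewrite /joined -[RHS](equivalence_partition_pblock pQ).
apply: eq_in_imset => x xD; apply/setP => y; rewrite !inE; apply: andb_id2l => yD.
have /andP[VQ xV] := pblockQ xD; set V := pblock Q x in VQ xV *.
apply/idP/idP => [cxy|yV].
  have [] // := andP (connect_stable (U := mem V) (e' := touch P) _ xV cxy).
  move=> u v uV uv; rewrite uv /=; case/touchP: uv => W [i [j [WP iW jW iu jv]]].
  have [V' V'Q WV'] := PV _ WP.
  have -> : V = V' by apply: (sameV _ _ u); rewrite // -iu; apply: qV iW.
  by rewrite -jv; apply: qV jW.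
have /andP[_ /forall_inP/(_ _ xV)/forall_inP/(_ _ yV)] := good _ VQ.
apply: connect_sub => u v /touchP[W [i [j [+ iW jW <- <-]]]].
by rewrite inE => /andP[WP _]; apply: connect1; apply: touch_mem WP iW jW.
Qed.

End Refinement.

(** The formula for cumulants with products as entries: sort the partitions upstairs
by the partition that they induce downstairs; those that induce Q are the families
of partitions, one over each block of Q, that connect that block. *)
Theorem NC_sum_preimset (K : comNzRingType) (h : {set 'I_N} -> K) D :
  NC_sum h (q @^-1: D) =
  NC_sum (fun V => \sum_(P in NC_of (q @^-1: V) | linked V P) \prod_(W in P) h W) D.
Proof.
rewrite /NC_sum (partition_big (joined D) (mem (NC_of D))) /=; last first.
  by move=> P /joined_NC.
apply: eq_bigr => Q QD.
have pQ : partition Q D by move: QD; rewrite inE => /andP[].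
pose good V E := (E \in NC_of (q @^-1: V)) && linked V E.
pose weight V E := if good V E then \prod_(W in E) h W else 0.
transitivity (\prod_(V in Q) \sum_(E in powerset (parts_in V)) weight V E); last first.
  apply: eq_bigr => V VQ; rewrite -big_mkcondr /=; apply: eq_bigl => E.
  rewrite /good inE; case EV: (E \in _); rewrite ?andbF //=.
  suff -> : E \subset parts_in V by [].
  move: EV; rewrite inE => /andP[pE _]; apply/subsetP => W WE.
  by rewrite in_parts (partition_neq0 pE) ?(partitionS pE).
rewrite -big_subset_distr; last exact: parts_disjoint pQ.
rewrite [RHS](bigID (fun E : {set {set 'I_N}} => [forall V in Q, good V (E :&: parts_in V)])) /=.
rewrite [X in _ = _ + X]big1 ?addr0; last first.
  move=> E /andP[_]; rewrite negb_forall_in => /exists_inP[V VQ /negPf bad].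
  by rewrite (bigD1 V) //= /weight bad mul0r.
apply: eq_big => [P|P /andP[PD /eqP jP]].
  rewrite powersetE; apply/idP/idP => [/andP[PD /eqP jP]|/andP[PQ /forall_inP gP]].
    have [-> gP] := joined_restrict QD PD jP.
    by apply/forall_inP => V VQ; apply: gP.
  by have [-> ->] := joined_glue QD PQ gP; rewrite eqxx.
have [/subsetP PQ gP] := joined_restrict QD PD jP.
rewrite [RHS](eq_bigr (fun V => \prod_(W in P | W \in parts_in V) h W)); last first.
  by move=> V VQ; rewrite /weight /good gP //; apply: eq_bigl => W; rewrite inE.
rewrite (exchange_big_dep (mem P)) /=; last by move=> V W _ /andP[].
apply: eq_bigr => W WP; have /bigcupP[V VQ WV] := PQ _ WP.
rewrite (big_pred1 V) // => V'; rewrite WP; apply/andP/eqP => [[V'Q WV']|-> //].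
apply/eqP; apply: contraT => VV.
have := parts_disjoint pQ V'Q VQ VV.
by rewrite disjoint_subset => /subsetP/(_ _ WV'); rewrite inE WV.
Qed.

End Grouping.

(** * Centring *)

(** Take two points i < l of a block at minimal distance. If i + 1 < l, the block of
i + 1 contains another point; whether it lies inside or outside the interval from
i to l, there results a closer pair in one block. *)
Lemma NC_of_singleton_or_adjacent k (P : {set {set 'I_k.+1}}) :
    P \in NC_of setT ->
  (exists j, [set j] \in P) \/
  (exists V i j, [/\ V \in P, i \in V, j \in V & j = i.+1 :> nat]).
Proof.
rewrite inE => /andP[pP ncP].
have [/existsP[j jP]|] := boolP [exists j, [set j] \in P]; first by left; exists j.
rewrite negb_exists => /forallP nosing; right.
have covP x : x \in cover P by rewrite (cover_partition pP) inE.
have other x : exists2 y, y \in pblock P x & y != x.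
  apply/exists_inP; apply: contraT; rewrite negb_exists_in => /forall_inP all_x.
  have : [set x] \in P; last by rewrite (negPf (nosing x)).
  suff -> : [set x] = pblock P x by apply: pblock_mem.
  apply/setP => y; rewrite inE; apply/eqP/idP => [->|/all_x]; first by rewrite mem_pblock.
  by rewrite negbK => /eqP.
have same V W x : V \in P -> W \in P -> x \in V -> x \in W -> V = W.
  move=> VP WP xV xW; rewrite -(def_pblock (partition_trivIset pP) VP xV).
  exact: (def_pblock (partition_trivIset pP) WP xW).
suff close d V (i l : 'I_k.+1) : V \in P -> i \in V -> l \in V -> (i < l)%N ->
    (l - i <= d)%N ->
    exists V i j, [/\ V \in P, i \in V, j \in V & j = i.+1 :> nat].
  have [y y0 yn0] := other ord0.
  apply: (close y (pblock P ord0) ord0 y); rewrite ?pblock_mem ?mem_pblock ?subn0 //.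
  by rewrite lt0n -(inj_eq val_inj) in yn0 *.
elim: d V i l => [|d IH] V i l VP iV lV il lid.
  by move: il; rewrite -subn_gt0 ltnNge lid.
have [li|li] := eqVneq (val l) i.+1; first by exists V, i, l.
have ml : (i.+1 < l)%N by rewrite ltn_neqAle eq_sym li.
have mk : (i.+1 < k.+1)%N by apply: ltn_trans ml (ltn_ord l).
pose m := Ordinal mk; have mW : m \in pblock P m by rewrite mem_pblock.
have WP : pblock P m \in P by apply: pblock_mem.
have lmd : (l - m <= d)%N by rewrite /= subnS -ltnS; case: (l - i)%N lid.
have [r rW rm] := other m.
have useV : V = pblock P m -> exists V i j, [/\ V \in P, i \in V, j \in V & j = i.+1 :> nat].
  by move=> VW; apply: (IH V m l); rewrite // VW.
have [ri|ir|/val_inj ri] := ltngtP r i; last by apply/useV/(same _ _ i); rewrite // -ri.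
  by apply/useV/esym; apply: (noncrossingP _ ncP _ _ r i m l) => //=.
have [rl|lr|/val_inj rl] := ltngtP r l; last by apply/useV/(same _ _ l); rewrite // -rl.
  apply: (IH (pblock P m) m r) => //.
    by rewrite ltn_neqAle ir andbT eq_sym -(inj_eq val_inj) in rm *.
  by apply: leq_trans lmd; apply: leq_sub2r; apply: ltnW.
by apply: useV; apply: (noncrossingP _ ncP _ _ i m l r) => //=.
Qed.

Lemma NC_of_set1_eq n (j : 'I_n) P : P \in NC_of [set j] -> P = [set [set j]].
Proof.
rewrite inE => /andP[pP _]; apply: (partition_trivial pP).
have : j \in cover P by rewrite (cover_partition pP) set11.
case/bigcupP=> V VP jV; suff <- : V = [set j] by [].
apply/eqP; rewrite eqEsubset (partitionS pP VP) /=.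
by apply/subsetP => x /set1P->.
Qed.

Lemma NC_sum_set1 (K : comNzRingType) n (g : {set 'I_n} -> K) j :
  NC_sum g [set j] = g [set j].
Proof.
rewrite /NC_sum (big_pred1 [set [set j]]) ?big_set1 // => P.
apply/idP/eqP => [/NC_of_set1_eq//|->].
by apply: NC_of_set1; apply/set0Pn; exists j; rewrite set11.
Qed.

Section Centering.
Variables (K : comNzRingType) (n : nat).
Implicit Types (S : {set 'I_n}) (P : {set {set 'I_n}}).

Let sing S : {set {set 'I_n}} := set1 @: S.

Let singP S V : reflect (exists2 j, j \in S & V = [set j]) (V \in sing S).
Proof. exact: imsetP. Qed.

(** Singleton blocks never cross another block, so they can be added and removed
freely. *)
Lemma NC_sum_add_singletons (g : {set 'I_n} -> K) S :
  (\prod_(j in S) g [set j]) * NC_sum g (~: S) =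
  \sum_(P in NC_of setT | [forall j in S, [set j] \in P]) \prod_(V in P) g V.
Proof.
rewrite /NC_sum big_distrr /=.
have disj P : partition P (~: S) -> [disjoint sing S & P].
  move=> pP; rewrite disjoint_subset; apply/subsetP => _ /singP[j jS ->].
  rewrite inE; apply/negP => /(partitionS pP)/subsetP/(_ j).
  by rewrite set11 inE jS => /(_ isT).
rewrite [RHS](reindex_onto (fun P => sing S :|: P) (fun P => P :\: sing S)) /=; last first.
  move=> P /andP[_ /forall_inP SP]; rewrite setUC setDE -[RHS]setIT -(setUCr (sing S)).
  rewrite setIUr setUC; congr (_ :|: _); apply/esym/setIidPr.
  by apply/subsetP => _ /singP[j jS ->]; apply: SP.
apply: eq_big => [P|P].
  apply/idP/andP => [PN|[/andP[PN _] /eqP PE]].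
    have pP : partition P (~: S) by move: PN; rewrite inE => /andP[].
    have ncP : noncrossing P by move: PN; rewrite inE => /andP[].
    split; last first.
      by rewrite setDUl setDv set0U; apply/eqP/setDidPl; rewrite disjoint_sym disj.
    apply/andP; split; last first.
      by apply/forall_inP => j jS; rewrite inE imset_f.
    rewrite inE; apply/andP; split.
      apply/and3P; split.
      - rewrite /cover bigcup_setU -/(cover P) (cover_partition pP).
        apply/eqP/setP => x; rewrite !inE; case: (boolP (x \in S)) => xS; rewrite ?orbT //= orbF.
        by apply/bigcupP; exists [set x]; rewrite ?imset_f ?set11.
      - apply/trivIsetP => A B; rewrite !inE.
        have dS j C : C \in P -> j \in S -> [disjoint [set j] & C].
          move=> CP jS; rewrite disjoints1; apply/negP => /(subsetP (partitionS pP CP)).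
          by rewrite inE jS.
        case/orP=> [/singP[i iS ->]|AP] /orP[/singP[j jS ->]|BP] AB.
        + by rewrite disjoints1 inE; apply: contraNneq AB => ->.
        + exact: dS.
        + by rewrite disjoint_sym dS.
        + exact: (trivIsetP (partition_trivIset pP)).
      - rewrite inE negb_or (partition0 pP) andbT; apply/negP => /singP[j _ /setP/(_ j)].
        by rewrite !inE eqxx.
    apply/noncrossingP => V W i j k l; rewrite !inE.
    case/orP=> [/singP[x xS ->]|VP].
      by move=> _ /set1P-> _ /set1P-> _ xj jx; move: (ltn_trans xj jx); rewrite ltnn.
    case/orP=> [/singP[x xS ->]|WP].
      by move=> _ /set1P-> _ /set1P-> _ xk kx; move: (ltn_trans xk kx); rewrite ltnn.
    by move/noncrossingP: ncP; apply.
  move: PN; rewrite !inE => /andP[pU /noncrossingP ncU].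
  have dP : [disjoint sing S & P].
    rewrite disjoint_sym disjoint_subset; apply/subsetP => V.
    by rewrite -{1}PE !inE => /andP[].
  apply/andP; split; last first.
    by apply/noncrossingP => V W i j k l VP WP; apply: ncU; rewrite inE ?VP ?WP orbT.
  have SU j : j \in S -> [set j] \in sing S :|: P by move=> jS; rewrite inE imset_f.
  apply/and3P; split.
  - apply/eqP/setP => x; rewrite inE; apply/bigcupP/idP => [[V VP xV]|xS].
      apply/negP => xS; have VU : V \in sing S :|: P by rewrite inE VP orbT.
      have := def_pblock (partition_trivIset pU) VU xV.
      rewrite (def_pblock (partition_trivIset pU) (SU _ xS)) ?set11 // => VE.
      move: dP; rewrite disjoint_subset => /subsetP/(_ V).
      by rewrite inE VP -VE imset_f // => /(_ isT).
    have : x \in cover (sing S :|: P) by rewrite (cover_partition pU) inE.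
    case/bigcupP=> V; rewrite inE => /orP[/singP[j jS ->]|VP xV]; last by exists V.
    by move=> /set1P xj; rewrite xj jS in xS.
  - exact: trivIsetS (subsetUr _ _) (partition_trivIset pU).
  - by have := partition0 pU; rewrite inE => /norP[].
rewrite inE => /andP[pP _]; rewrite [RHS](eq_bigl [predU sing S & P]) => [|V]; last by rewrite !inE.
rewrite bigU ?disj //=.
by rewrite big_imset //= => i j _ _ /set1_inj.
Qed.

(** Inclusion-exclusion: the left-hand side is the sum over P of the product of the
weights of its blocks, times (1 - 1) for each singleton block. The sum over S is
the one that arises from expanding a moment of centred variables. *)
Lemma sum_centered_eq0 (g : {set 'I_n} -> K) :
    (forall P, P \in NC_of setT -> (exists j, [set j] \in P) \/
       (exists2 V, V \in P & g V = 0)) ->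
  \sum_(S : {set 'I_n}) (\prod_(j in S) - g [set j]) * NC_sum g (~: S) = 0.
Proof.
move=> gP.
have E1 (S : {set 'I_n}) : (\prod_(j in S) - g [set j]) * NC_sum g (~: S) =
    \sum_(P in NC_of setT)
      (\prod_(V in P) g V) * \prod_(j in S) - ([set j] \in P)%:R.
  under eq_bigr do rewrite -mulN1r.
  rewrite big_split -mulrA NC_sum_add_singletons big_distrr big_mkcondr /=.
  apply: eq_bigr => P _; case: ifP => [/forall_inP SP|/negbT].
    by rewrite mulrC; congr (_ * _); apply: eq_bigr => j /SP->.
  rewrite negb_forall_in => /exists_inP[j jS /negPf jP].
  by rewrite (bigD1 j jS) /= jP oppr0 mul0r mulr0.
under eq_bigr do rewrite E1.
rewrite exchange_big big1 //= => P PN; rewrite -big_distrr /=.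
under [X in _ * X]eq_bigr do rewrite big_mkcond /=.
rewrite -(bigA_distr _ _ (fun j => - ([set j] \in P)%:R) (fun=> 1)) /=.
have [[j jP]|[V VP gV]] := gP P PN.
  by rewrite [X in _ * X](bigD1 j) //= jP addNr mul0r mulr0.
by rewrite (bigD1 V VP) /= gV !mul0r.
Qed.

End Centering.

(** * Moments of words in two free variables *)

(** The map q numbers the maximal runs of c: q i counts the changes of colour before
i, hence its parity gives the colour. *)
Lemma color_runs N (c : 'I_N.+1 -> bool) :
  exists k (q : 'I_N.+1 -> 'I_k.+1),
    [/\ {homo q : i j / (i <= j)%N}, forall j, exists i, q i = j &
        forall i, c i = c ord0 (+) odd (q i)].
Proof.
pose d i := c (inord i) != c (inord i.+1).
pose r m := (\sum_(0 <= i < m) d i)%N.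
have r_homo : {homo r : i j / (i <= j)%N}.
  by move=> i j ij; rewrite /r [X in (_ <= X)%N](big_cat_nat (n := i)) //= leq_addr.
have rS m : r m.+1 = (r m + d m)%N by rewrite /r big_nat_recr.
have r0 : r 0%N = 0%N by rewrite /r big_geq.
have rk (i : 'I_N.+1) : (r i < (r N).+1)%N by rewrite ltnS r_homo // -ltnS.
exists (r N), (fun i => Ordinal (rk i)); split=> [i j|j|i]; first exact: r_homo.
  have surj m : (j <= r m)%N -> exists2 i, (i <= m)%N & r i = j.
    elim: m => [|m IH]; first by rewrite r0 leqn0 => /eqP->; exists 0%N.
    have [jm _|mj] := leqP j (r m).
      by have [i im ri] := IH jm; exists i; rewrite ?(leq_trans im).
    rewrite rS => jm; exists m.+1; rewrite // rS; apply/eqP; rewrite eqn_leq jm andbT.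
    by apply: leq_trans mj; rewrite -addn1 leq_add2l leq_b1.
  have [i iN ri] := surj N (ltn_ord j).
  by exists (inord i); apply: val_inj; rewrite /= inordK.
rewrite /= -[c i]/(c i) -{1}(inord_val i); elim: (val i) => [|m IH].
  by rewrite r0 addbF; congr c; apply: val_inj; rewrite /= inordK.
rewrite rS oddD addbA -IH /d oddb; by case: (c _); case: (c _).
Qed.

Section Free.
Variables (K : comNzRingType) (A : algType K) (phi : {scalar A}).
Hypothesis phi1 : phi 1 = 1.
Variables a b : A.

Definition ab_letter (x : bool) : A := if x then a else b.

(** The cumulant of the letters at the positions in W, if mixed cumulants vanish. *)
Definition mono_kappa n (c : 'I_n -> bool) (W : {set 'I_n}) : K :=
  if W \subset [set i | c i] then kappa phi #|W| a
  else if W \subset [set i | ~~ c i] then kappa phi #|W| b else 0.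

Lemma mono_kappaE n (c : 'I_n -> bool) (W : {set 'I_n}) x : W != set0 -> {in W, forall i, c i = x} ->
  mono_kappa c W = kappa phi #|W| (ab_letter x).
Proof.
rewrite /mono_kappa => /set0Pn[i iW] cx.
have Wx y : (W \subset [set j | c j == y]) = (x == y).
  apply/subsetP/eqP => [/(_ i iW)|<- j jW]; rewrite inE cx //; exact: eqP.
have -> : [set j | c j] = [set j | c j == true] by apply/setP => j; rewrite !inE eqb_id.
have -> : [set j | ~~ c j] = [set j | c j == false] by apply/setP => j; rewrite !inE eqbF_neg.
rewrite !Wx.
by case: x {cx Wx}.
Qed.

Lemma mono_kappa_neq0 n (c : 'I_n -> bool) (W : {set 'I_n}) :
  mono_kappa c W != 0 -> {in W &, forall i j, c i = c j}.
Proof.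
rewrite /mono_kappa; case: ifP => [/subsetP Wc _ i j /Wc + /Wc|_].
  by rewrite !inE => -> ->.
case: ifP => [/subsetP Wc _ i j /Wc + /Wc|_]; last by rewrite eqxx.
by rewrite !inE => /negPf-> /negPf->.
Qed.

Lemma eq_mono_kappa n (c c' : 'I_n -> bool) (W : {set 'I_n}) : {in W, c =1 c'} ->
  mono_kappa c W = mono_kappa c' W.
Proof.
move=> cc; rewrite /mono_kappa.
have E (p : bool -> bool) : (W \subset [set i | p (c i)]) = (W \subset [set i | p (c' i)]).
  by apply/subsetP/subsetP => Wp i iW; have := Wp i iW; rewrite !inE cc.
by rewrite (E id) (E negb).
Qed.

Lemma mono_kappa_imset m n (f : 'I_m -> 'I_n) (c : 'I_n -> bool) (W : {set 'I_m}) : injective f ->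
  mono_kappa c (f @: W) = mono_kappa (c \o f) W.
Proof.
move=> fI; rewrite /mono_kappa card_imset //.
have E (p : pred bool) : (f @: W \subset [set i | p (c i)]) = (W \subset [set i | p (c (f i))]).
  by rewrite sub_imset_pre; apply: eq_subset_r => i; rewrite !inE.
by rewrite (E id) (E negb).
Qed.

Lemma pure_moment n (c : 'I_n -> bool) x (D : {set 'I_n}) :
    {in D, forall i, c i = x} ->
  phi (ab_letter x ^+ #|D|) = NC_sum (mono_kappa c) D.
Proof.
move=> cx; rewrite -prodr_const (moment_NC_sum phi1 (fun=> ab_letter x)).
apply: eq_NC_sum => V V0 /subsetP VD.
rewrite (mono_kappaE (x := x)) // => [|i /VD/cx//].
by rewrite /kappa cardE; congr free_cumulant; elim: (enum V) => //= i s ->.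
Qed.

Lemma prod_scalar_mix k (S : {set 'I_k}) (d : 'I_k -> K) (y : 'I_k -> A) :
  \prod_j (if j \in S then (d j)%:A else y j) =
  (\prod_(j in S) d j) *: \prod_(j in ~: S) y j.
Proof.
under [X in _ *: X]eq_bigl do rewrite inE.
elim: (index_enum _) => [|j s IH]; first by rewrite !big_nil scale1r.
rewrite !big_cons IH; case: ifP => jS /=.
  by rewrite mulr_algl scalerA.
by rewrite -scalerAr.
Qed.

Hypothesis free_ab : freely_independent phi a b.

Lemma free_centered k (x0 : bool) (m : 'I_k.+1 -> nat) :
  let y (j : 'I_k.+1) := ab_letter (x0 (+) odd j) ^+ m j in
  phi (\prod_j (y j - (phi (y j))%:A)) = 0.
Proof.
move=> y.
pose l (j : 'I_k.+1) := (x0 (+) odd j, 'X^(m j) - (phi (y j))%:P).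
have lE j : letter a b (l j) = y j - (phi (y j))%:A.
  by rewrite /letter /= rmorphB rmorphXn /= horner_algX horner_algC.
have := free_ab (w := [seq l j | j <- enum 'I_k.+1]).
rewrite big_map -prod_enum; under eq_bigr do rewrite lE.
apply.
- by rewrite -size_eq0 size_map size_enum_ord.
- rewrite sorted_map.
  have := iota_ltn_sorted 0 k.+1.
  have : sorted (fun i j => odd i != odd j) (map val (enum 'I_k.+1)).
    rewrite val_enum_ord /=; elim: (k) 0%N => //= m' IH i.
    by rewrite IH andbT; case: odd.
  rewrite sorted_map => + _; apply: sub_sorted => i j /=.
  by apply: contraNneq => /addbI->.
- move=> _ /mapP[j _ ->]; rewrite lE linearB linearZ /= phi1.
  by rewrite mulr1 subrr.
Qed.

(** If all blocks are monochromatic, connected runs have the same colour; but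
neighbouring runs have different ones. *)
Lemma linked_adjacent_eq0 N k (c : 'I_N -> bool) (q : 'I_N -> 'I_k) x0
    (V : {set 'I_k}) (i j : 'I_k) :
    (forall i, c i = x0 (+) odd (q i)) -> i \in V -> j \in V -> j = i.+1 :> nat ->
  \sum_(P in NC_of (q @^-1: V) | linked q V P) \prod_(W in P) mono_kappa c W = 0.
Proof.
move=> cq iV jV ji; apply: big1 => P /andP[_ /forall_inP/(_ i iV)/forall_inP/(_ j jV) ij].
have [/exists_inP[W WP /eqP W0]|] := boolP [exists W in P, mono_kappa c W == 0].
  by rewrite (bigD1 W) //= W0 mul0r.
rewrite negb_exists_in => /forall_inP nz.
have [//||_] := andP (connect_stable (e' := touch q P) (U := fun l => odd l == odd i) _ _ ij).
- move=> u v /eqP ui uv; rewrite uv /= -ui.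
  case/touchP: uv => W [s [t [WP sW tW <- <-]]].
  have := mono_kappa_neq0 (nz _ WP) sW tW; rewrite !cq => /addbI->.
  by rewrite eqxx.
- exact: eqxx.
by rewrite ji /=; case: odd.
Qed.

(** Both sides satisfy the relation obtained by centring all runs. Its term for the
empty S is the word itself, and the other terms concern shorter words since every
run is nonempty. *)
Lemma free_moment_runs N k (c : 'I_N -> bool) (q : 'I_N -> 'I_k.+1) x0 :
    {homo q : i j / (i <= j)%N} -> (forall j, exists i, q i = j) ->
    (forall i, c i = x0 (+) odd (q i)) ->
    (forall D : {set 'I_N}, D != setT ->
       phi (\prod_(i in D) ab_letter (c i)) = NC_sum (mono_kappa c) D) ->
  phi (\prod_(i in setT) ab_letter (c i)) = NC_sum (mono_kappa c) setT.
Proof.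
move=> q_homo q_surj cq IH.
pose m (j : 'I_k.+1) := #|q @^-1: [set j]|.
pose y (j : 'I_k.+1) := ab_letter (x0 (+) odd j) ^+ m j.
pose g (V : {set 'I_k.+1}) := \sum_(P in NC_of (q @^-1: V) | linked q V P) \prod_(W in P) mono_kappa c W.
have NCg (X : {set 'I_k.+1}) : NC_sum (mono_kappa c) (q @^-1: X) = NC_sum g X.
  exact: NC_sum_preimset.
have cj (j : 'I_k.+1) : {in q @^-1: [set j], forall i, c i = x0 (+) odd j}.
  by move=> i; rewrite !inE cq => /eqP->.
have yX (X : {set 'I_k.+1}) : \prod_(j in X) y j = \prod_(i in q @^-1: X) ab_letter (c i).
  rewrite (prod_preimset _ _ q_homo); apply: eq_bigr => j _.
  by rewrite /y /m -prodr_const; apply: eq_bigr => i /cj->.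
have gy j : g [set j] = phi (y j).
  by rewrite -NC_sum_set1 -NCg -(pure_moment (@cj j)).
have moments0 : \sum_(S : {set 'I_k.+1})
    (\prod_(j in S) - g [set j]) * phi (\prod_(j in ~: S) y j) = 0.
  rewrite -[RHS](free_centered x0 m) -/y.
  under [in RHS]eq_bigr do rewrite addrC -scaleNr.
  rewrite bigA_distr linear_sum; apply: eq_bigr => S _ /=.
  rewrite prod_scalar_mix linearZ /=; congr (_ * _).
  by apply: eq_bigr => j _; rewrite gy.
have cumulants0 : \sum_(S : {set 'I_k.+1})
    (\prod_(j in S) - g [set j]) * NC_sum g (~: S) = 0.
  apply: sum_centered_eq0 => P /NC_of_singleton_or_adjacent[|]; first by left.
  move=> [V [i [j [VP iV jV ji]]]]; right; exists V => //.
  exact: linked_adjacent_eq0 cq iV jV ji.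
have := etrans moments0 (esym cumulants0); rewrite (bigD1 set0) //= [RHS](bigD1 set0) //=.
rewrite !big_set0 !mul1r setC0 -NCg yX preimsetT.
rewrite [X in _ + X = _ -> _](_ : _ = \sum_(S : {set 'I_k.+1} | S != set0)
    (\prod_(j in S) - g [set j]) * NC_sum g (~: S)); first by move/addIr.
apply: eq_bigr => S /set0Pn[j jS]; rewrite -NCg yX IH //.
have [i qi] := q_surj j; apply/eqP => /setP/(_ i).
by rewrite !inE qi jS.
Qed.

(** Vanishing of mixed cumulants, in the form of a formula for the moments. *)
Theorem free_moment n (c : 'I_n -> bool) (D : {set 'I_n}) :
  phi (\prod_(i in D) ab_letter (c i)) = NC_sum (mono_kappa c) D.
Proof.
move mE: #|D| => m; elim/ltn_ind: m n c D mE => -[|N] IH n c D mE.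
  by move/cards0_eq: mE => ->; rewrite big_set0 NC_sum0.
have [f f_mono <-] := set_param mE.
rewrite (prod_imset _ _ f_mono) (NC_sum_imset f_mono).
rewrite [RHS](@eq_NC_sum _ _ _ (mono_kappa (c \o f))); last first.
  by move=> V _ _; rewrite mono_kappa_imset //; apply: mono_ord_inj f_mono.
have [k [q [q_homo q_surj cq]]] := color_runs (c \o f).
apply: (free_moment_runs q_homo q_surj cq) => E ET.
apply: (IH #|E|) => //.
have : E \proper setT by rewrite properT.
by move/proper_card; rewrite cardsT card_ord.
Qed.

End Free.

(** * Expansion of the anticommutator *)

Lemma prod_has0 (A : pzRingType) (I : eqType) (s : seq I) (x : I -> A) i :
  i \in s -> x i = 0 -> \prod_(j <- s) x j = 0.
Proof.
move=> + xi; elim: s => // j s IH; rewrite inE big_cons => /predU1P[<-|/IH->].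
  by rewrite xi mul0r.
by rewrite mulr0.
Qed.

Section Pairing.
Variable n : nat.

Lemma fst_pos_subproof (k : 'I_n) : (2 * k < 2 * n)%N.
Proof. by rewrite ltn_pmul2l. Qed.

Lemma snd_pos_subproof (k : 'I_n) : ((2 * k).+1 < 2 * n)%N.
Proof. by rewrite !mul2n ltn_Sdouble. Qed.

Lemma pair_of_subproof (i : 'I_(2 * n)) : (i./2 < n)%N.
Proof.
rewrite -ltn_double -[n.*2]mul2n; apply: leq_ltn_trans (ltn_ord i).
by rewrite -[leqRHS]odd_double_half leq_addl.
Qed.

Definition fst_pos k := Ordinal (fst_pos_subproof k).
Definition snd_pos k := Ordinal (snd_pos_subproof k).
Definition pair_of i := Ordinal (pair_of_subproof i).

Lemma pair_of_homo : {homo pair_of : i j / (i <= j)%N}.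
Proof. by move=> i j; apply: half_leq. Qed.

Lemma pair_of_fst k : pair_of (fst_pos k) = k.
Proof. by apply: val_inj; rewrite /= mul2n doubleK. Qed.

Lemma pair_of_snd k : pair_of (snd_pos k) = k.
Proof. by apply: val_inj; rewrite /= mul2n uphalf_double. Qed.

Lemma odd_fst k : odd (fst_pos k) = false.
Proof. by rewrite /= mul2n odd_double. Qed.

Lemma odd_snd k : odd (snd_pos k).
Proof. by rewrite /= mul2n odd_double. Qed.

Variant pos_spec : 'I_(2 * n) -> Type :=
  | PosFst k : pos_spec (fst_pos k)
  | PosSnd k : pos_spec (snd_pos k).

Lemma posP i : pos_spec i.
Proof.
have [oi|ei] := boolP (odd i).
  suff -> : i = snd_pos (pair_of i) by constructor.
  by apply: val_inj; have := odd_double_half i; rewrite oi /= [(2 * i./2)%N]mul2n add1n => ->.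
suff -> : i = fst_pos (pair_of i) by constructor.
by apply: val_inj; have := odd_double_half i; rewrite (negPf ei) /= [(2 * i./2)%N]mul2n add0n => ->.
Qed.

Lemma prod_pair (A : pzRingType) (x : 'I_(2 * n) -> A) k :
  \prod_(i in pair_of @^-1: [set k]) x i = x (fst_pos k) * x (snd_pos k).
Proof.
rewrite prod_enum; suff -> : enum (pair_of @^-1: [set k]) = [:: fst_pos k; snd_pos k].
  by rewrite !big_cons big_nil mulr1.
apply: (@inj_map _ _ (val : 'I_(2 * n) -> nat)); first exact: val_inj.
apply: (irr_sorted_eq ltn_trans ltnn); [exact: ltn_sorted_enum | by rewrite /= ltnSn|].
move=> m; apply: eq_mem_map m => i; rewrite mem_enum !inE.
by apply/eqP/orP => [<-|[/eqP->|/eqP->]]; rewrite ?pair_of_fst ?pair_of_snd //;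
   case: (posP i) => l; rewrite ?pair_of_fst ?pair_of_snd; [left|right].
Qed.

(** The k-th pair of letters is ab if k is in E, and ba otherwise; a is the colour
[true]. *)
Definition word_color (E : {set 'I_n}) (i : 'I_(2 * n)) : bool :=
  (pair_of i \in E) (+) odd i.

Lemma word_color_fst E k : word_color E (fst_pos k) = (k \in E).
Proof. by rewrite /word_color pair_of_fst odd_fst addbF. Qed.

Lemma word_color_snd E k : word_color E (snd_pos k) = (k \notin E).
Proof. by rewrite /word_color pair_of_snd odd_snd addbT. Qed.

End Pairing.

Section Anticommutator.
Variables (K : comNzRingType) (A : algType K) (phi : {scalar A}).
Hypothesis phi1 : phi 1 = 1.
Variables a b : A.
Hypothesis free_ab : freely_independent phi a b.
Variable n : nat.

Let word_sum (E V : {set 'I_n}) : K :=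
  \sum_(P in NC_of (@pair_of n @^-1: V) | linked (@pair_of n) V P)
    \prod_(W in P) mono_kappa phi a b (word_color E) W.

Lemma moment_word (E D : {set 'I_n}) :
  phi (\prod_(k in D) (if k \in E then a * b else b * a)) = NC_sum (word_sum E) D.
Proof.
rewrite -NC_sum_preimset; last exact: pair_of_homo.
rewrite -free_moment // prod_preimset; last exact: pair_of_homo.
congr (phi _); apply: eq_bigr => k _.
by rewrite prod_pair word_color_fst word_color_snd; case: (k \in E).
Qed.

(** Factors 0 and 1 outside D make the expansion over all subsets of [n] reduce to
the subsets of D. *)
Lemma anticommutator_expand (D : {set 'I_n}) :
  (a * b + b * a) ^+ #|D| =
  \sum_(E in powerset D) \prod_(k in D) (if k \in E then a * b else b * a).
Proof.
rewrite -prodr_const big_mkcond /=.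
rewrite (eq_bigr (fun k => (if k \in D then a * b else 0) +
                           (if k \in D then b * a else 1))); last first.
  by move=> k _; case: ifP; rewrite ?add0r.
rewrite bigA_distr (bigID (mem (powerset D))) /= [X in _ + X]big1 ?addr0.
  apply: eq_big => [E|E]; first by rewrite !inE.
  rewrite inE => /subsetP ED; rewrite [RHS]big_mkcond /=; apply: eq_bigr => k _.
  by case: ifP => [/ED->//|_].
move=> E; rewrite inE => /subsetPn[k kE /negPf kD].
by apply: (@prod_has0 _ _ _ _ k); rewrite ?kE ?kD.
Qed.

(** Only the choices made in V matter; this allows the sum over E to be distributed
over the blocks of a partition. *)
Lemma word_sum_setI (E V : {set 'I_n}) : word_sum E V = word_sum (E :&: V) V.
Proof.
apply: eq_bigr => P /andP[]; rewrite inE => /andP[pP _] _; apply: eq_bigr => W WP.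
apply: eq_mono_kappa => i iW; rewrite /word_color inE.
by have := subsetP (partitionS pP WP) _ iW; rewrite inE => ->; rewrite andbT.
Qed.

Lemma kappa_anticommutator_words (D : {set 'I_n}) : D != set0 ->
  kappa phi #|D| (a * b + b * a) = \sum_(E in powerset D) word_sum E D.
Proof.
move: D; apply: (@NC_sum_inj _ _ (fun D : {set 'I_n} => kappa phi #|D| (a * b + b * a))
  (fun D => \sum_(E in powerset D) word_sum E D)) => D _.
 transitivity (phi ((a * b + b * a) ^+ #|D|)).
  rewrite -prodr_const (moment_NC_sum phi1 (fun=> a * b + b * a)).
  apply: eq_NC_sum => V _ _; rewrite /kappa cardE; congr free_cumulant.
  by elim: (enum V) => //= i s ->.
rewrite anticommutator_expand linear_sum /=.
under eq_bigr do rewrite moment_word.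
rewrite exchange_big; apply: eq_bigr => P; rewrite inE => /andP[pP _] /=.
rewrite -big_subset_distr; last first.
  by move=> V V' VP V'P; apply: (trivIsetP (partition_trivIset pP)).
rewrite -/(cover P) (cover_partition pP); apply: eq_bigr => E _.
by apply: eq_bigr => V _; apply: word_sum_setI.
Qed.

End Anticommutator.

(** * The graph of pairs and its two colourings *)

(** Along every path f alternates, in particular along a shortest one. *)
Lemma dist_parity (T : finType) (e : rel T) (f : T -> bool) x y :
    (forall u v, e u v -> f v = ~~ f u) -> connect e x y ->
  f y = f x (+) odd (dist e x y).
Proof.
move=> fe /connectP[p0 ep0 yE].
have path_parity p : path e x p -> f (last x p) = f x (+) odd (size p).
  elim: p (x) => [|z p IH] u /=; first by rewrite addbF.
  by case/andP=> uz /IH->; rewrite (fe _ _ uz) addNb addbN.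
pose reach m := [exists p : m.-tuple T, path e x p && (last x p == y)].
have : has reach (iota 0 #|T|).
  move: yE; case/shortenP: ep0 => p ep up _ yE.
  apply/hasP; exists (size p).
    by rewrite mem_iota /= add0n; have := max_card (mem (x :: p)); rewrite (card_uniqP up).
  by apply/existsP; exists (in_tuple p); rewrite ep yE /=.
move=> hr; have := nth_find 0%N hr; rewrite -/(dist e x y).
rewrite nth_iota ?add0n; last by rewrite -[X in (_ < X)%N](size_iota 0) -has_find.
by case/existsP=> p /andP[/path_parity + /eqP yp]; rewrite yp size_tuple.
Qed.

Section PairGraph.
Variables (n : nat) (P : {set {set 'I_(2 * n)}}).
Hypothesis pP : partition P setT.

Local Notation block := (pblock P).

Lemma edge_fstE (k : 'I_n) : edge_fst P k = block (fst_pos k).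
Proof. by rewrite /edge_fst /block_at (valK (fst_pos k)). Qed.

Lemma edge_sndE (k : 'I_n) : edge_snd P k = block (snd_pos k).
Proof. by rewrite /edge_snd /block_at (valK (snd_pos k)). Qed.

Lemma mem_block i : i \in block i.
Proof. by rewrite mem_pblock (cover_partition pP) inE. Qed.

Lemma block_in i : block i \in P.
Proof. by rewrite pblock_mem // (cover_partition pP) inE. Qed.

Lemma blockE W i : W \in P -> i \in W -> block i = W.
Proof. exact: def_pblock (partition_trivIset pP). Qed.

Lemma graph_adj_fst_snd k : graph_adj P (block (fst_pos k)) (block (snd_pos k)).
Proof. by apply/existsP; exists k; rewrite edge_fstE edge_sndE !eqxx. Qed.

Lemma graph_adj_sym : symmetric (graph_adj P).
Proof.
by move=> V W; apply/existsP/existsP => -[k kVW]; exists k; rewrite orbC andbC [X in _ || X]andbC.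
Qed.

Lemma connect_pair (k : 'I_n) i : pair_of i = k ->
  connect (graph_adj P) (block (fst_pos k)) (block i).
Proof.
case: (posP i) => l; rewrite ?pair_of_fst ?pair_of_snd => ->; first exact: connect0.
exact/connect1/graph_adj_fst_snd.
Qed.

(** The graph on pairs, two pairs being adjacent when they meet a common block, and
the graph on blocks, two blocks being adjacent when they meet a common pair, are
connected at the same time. *)
Lemma linked_graph_connected : linked (@pair_of n) setT P = graph_connected P.
Proof.
have gsym := sym_connect_sym graph_adj_sym.
apply/forall_inP/forall_inP => [lk V VP|gc k _].
  apply/forall_inP => W WP.
  have [i iV] := set0Pn _ (partition_neq0 pP VP).
  have [j jW] := set0Pn _ (partition_neq0 pP WP).
  rewrite -(blockE VP iV) -(blockE WP jW).
  have /forall_inP/(_ (pair_of j) (in_setT _)) := lk (pair_of i) (in_setT _).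
  move=> ij; have : connect (graph_adj P) (block (fst_pos (pair_of i)))
                                          (block (fst_pos (pair_of j))).
    case/connectP: ij => p + ->; elim: p (pair_of i) => [|l p IH] k //=.
    case/andP=> kl /IH; apply: connect_trans.
    case/touchP: kl => U [s [t [UP sU tU sk tl]]].
    apply: (connect_trans (connect_pair sk)).
    by rewrite gsym (blockE UP sU) -(blockE UP tU) connect_pair.
  rewrite gsym => /(connect_trans)/(_ (connect_pair (erefl _))).
  by rewrite gsym => /(connect_trans)/(_ (connect_pair (erefl _))); rewrite gsym.
apply/forall_inP => l _.
have := gc _ (block_in (fst_pos k)) => /forall_inP/(_ _ (block_in (fst_pos l))) kl.
pose U (W : {set 'I_(2 * n)}) := [exists i in W, connect (touch (@pair_of n) P) k (pair_of i)].
have tm := @touch_mem _ _ (@pair_of n) P.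
have [] // := andP (connect_stable (e' := graph_adj P) (U := U) _ _ kl).
- move=> V W /exists_inP[i iV ki] VW; rewrite VW /=.
  case/existsP: VW => m; rewrite edge_fstE edge_sndE.
  case/orP=> /andP[/eqP VE /eqP WE]; apply/exists_inP.
  + exists (snd_pos m); first by rewrite WE mem_block.
    apply: (connect_trans ki); rewrite pair_of_snd -[X in connect _ _ X](pair_of_fst m).
    by apply/connect1/(tm V); rewrite // VE ?block_in ?mem_block.
  + exists (fst_pos m); first by rewrite WE mem_block.
    apply: (connect_trans ki); rewrite pair_of_fst -[X in connect _ _ X](pair_of_snd m).
    by apply/connect1/(tm V); rewrite // VE ?block_in ?mem_block.
- by apply/exists_inP; exists (fst_pos k); rewrite ?mem_block // pair_of_fst connect0.
move=> _ /exists_inP[i il ki]; apply: (connect_trans ki).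
rewrite -[X in connect _ _ X](pair_of_fst l).
by apply/connect1/(tm (block (fst_pos l))); rewrite ?block_in ?mem_block.
Qed.

Definition block_color (E : {set 'I_n}) : Prop :=
  forall W, W \in P -> {in W &, forall i j, word_color E i = word_color E j}.

Lemma block_color_bipartition E : block_color E ->
  exists2 S : {set {set 'I_(2 * n)}},
    forall i, (block i \in S) = word_color E i &
    [forall k : 'I_n, (edge_fst P k \in S) != (edge_snd P k \in S)].
Proof.
move=> Ecol; pose S := [set W in P | [exists i in W, word_color E i]].
have SE i : (block i \in S) = word_color E i.
  rewrite inE block_in; apply/exists_inP/idP => [[j ji]|ci]; last first.
    by exists i; rewrite ?mem_block.
  by rewrite (Ecol _ (block_in i) j i ji (mem_block i)).
exists S => //; apply/forallP => k.
by rewrite edge_fstE edge_sndE !SE word_color_fst word_color_snd; case: (_ \in _).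
Qed.

Hypothesis n_gt0 : (0 < n)%N.
Hypothesis connP : graph_connected P.

Let pos0 : 'I_(2 * n) := fst_pos (Ordinal n_gt0).
Let parity (W : {set 'I_(2 * n)}) := odd (dist (graph_adj P) (block_at P 0) W).

Lemma block_at0 : block_at P 0 = block pos0.
Proof. by rewrite /block_at -[0%N]/(val pos0) valK. Qed.

(** A bipartition of a connected graph is unique up to exchanging its sides. *)
Lemma bipartition_parity (S : {set {set 'I_(2 * n)}}) :
    [forall k : 'I_n, (edge_fst P k \in S) != (edge_snd P k \in S)] ->
  {in P, forall W, (W \in S) = (block pos0 \in S) (+) parity W}.
Proof.
move=> /forallP bip W WP; rewrite /parity block_at0.
apply: (@dist_parity _ _ (fun V => V \in S)); last first.
  by move/forall_inP: connP => /(_ _ (block_in _))/forall_inP/(_ _ WP).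
move=> U V /existsP[k /orP[]/andP[/eqP-> /eqP->]]; have := bip k;
by case: (_ \in S); case: (_ \in S).
Qed.

(** The set E whose word has the letter a exactly on the blocks at even distance from
the first one; its complement exchanges the letters. *)
Definition even_word : {set 'I_n} := [set k | ~~ parity (edge_fst P k)].

Lemma even_word_color : graph_bipartite P ->
  forall i, word_color even_word i = ~~ parity (block i).
Proof.
case/existsP=> S bip i.
have par := bipartition_parity bip.
case: (posP i) => k; rewrite ?word_color_fst ?word_color_snd inE edge_fstE //.
rewrite negbK; have := forallP bip k; rewrite edge_fstE edge_sndE.
rewrite (par _ (block_in (fst_pos k))) (par _ (block_in (snd_pos k))).
by move: (parity _) (parity _) (_ \in S) => [] [] [].
Qed.

Lemma even_word_colorC : graph_bipartite P ->
  forall i, word_color (~: even_word) i = parity (block i).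
Proof.
move=> bip i; rewrite -[RHS]negbK -(even_word_color bip) /word_color inE.
by rewrite addNb.
Qed.

Lemma block_color_cases E : block_color E -> E = even_word \/ E = ~: even_word.
Proof.
move=> /block_color_bipartition[S SE bip].
have par i := bipartition_parity bip (block_in i).
case x : (block pos0 \in S); [left|right]; apply/setP => k; rewrite !inE ?negbK;
  by rewrite -(word_color_fst E k) -SE edge_fstE par x.
Qed.

Variables (K : comNzRingType) (A : algType K) (phi : {scalar A}) (a b : A).

Lemma prod_mono_kappa_even : graph_bipartite P ->
  \prod_(W in P) mono_kappa phi a b (word_color even_word) W =
  (\prod_(V in even_blocks P) kappa phi #|V| a) *
  (\prod_(W in odd_blocks P) kappa phi #|W| b).
Proof.
move=> bip; rewrite (bigID parity) /= mulrC; congr (_ * _).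
  apply: eq_big => [W|W /andP[WP Wev]]; first by rewrite inE.
  rewrite (mono_kappaE _ _ _ (x := true)) ?(partition_neq0 pP) // => i iW.
  by rewrite even_word_color // (blockE WP iW).
apply: eq_big => [W|W /andP[WP Wodd]]; first by rewrite inE.
rewrite (mono_kappaE _ _ _ (x := false)) ?(partition_neq0 pP) // => i iW.
by rewrite even_word_color // (blockE WP iW) Wodd.
Qed.

Lemma prod_mono_kappa_odd : graph_bipartite P ->
  \prod_(W in P) mono_kappa phi a b (word_color (~: even_word)) W =
  (\prod_(V in even_blocks P) kappa phi #|V| b) *
  (\prod_(W in odd_blocks P) kappa phi #|W| a).
Proof.
move=> bip; rewrite (bigID parity) /= mulrC; congr (_ * _).
  apply: eq_big => [W|W /andP[WP /negPf Wev]]; first by rewrite inE.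
  rewrite (mono_kappaE _ _ _ (x := false)) ?(partition_neq0 pP) // => i iW.
  by rewrite even_word_colorC // (blockE WP iW).
apply: eq_big => [W|W /andP[WP Wodd]]; first by rewrite inE.
rewrite (mono_kappaE _ _ _ (x := true)) ?(partition_neq0 pP) // => i iW.
by rewrite even_word_colorC // (blockE WP iW).
Qed.

Lemma sum_word_colorings :
  \sum_(E : {set 'I_n}) \prod_(W in P) mono_kappa phi a b (word_color E) W =
  if graph_bipartite P then
    (\prod_(V in even_blocks P) kappa phi #|V| a) *
    (\prod_(W in odd_blocks P) kappa phi #|W| b) +
    (\prod_(V in even_blocks P) kappa phi #|V| b) *
    (\prod_(W in odd_blocks P) kappa phi #|W| a)
  else 0.
Proof.
have zero E : ~ block_color E -> \prod_(W in P) mono_kappa phi a b (word_color E) W = 0.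
  move=> ncol; have [/exists_inP[W WP /eqP W0]|] :=
    boolP [exists W in P, mono_kappa phi a b (word_color E) W == 0].
    by rewrite (bigD1 W) //= W0 mul0r.
  rewrite negb_exists_in => /forall_inP nz; case: ncol => W WP.
  exact: mono_kappa_neq0 (nz _ WP).
case: ifP => [bip|nbip]; last first.
  apply: big1 => E _; apply: zero => /block_color_bipartition[S _ bip].
  by move/negbT: nbip; rewrite negb_exists => /forallP/(_ S); rewrite bip.
have Eneq : ~: even_word != even_word.
  apply/eqP => /setP/(_ (Ordinal n_gt0)); rewrite !inE.
  by case: (parity _).
rewrite (bigD1 even_word) //= (bigD1 (~: even_word)) //= [X in _ + (_ + X)]big1 ?addr0.
  by rewrite prod_mono_kappa_even // prod_mono_kappa_odd.
move=> E /andP[/eqP E1 /eqP E2]; apply: zero => /block_color_cases[]//.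
Qed.

End PairGraph.

Theorem theorem1p4 (R : realType) (A : algType R[i]) (phi : {scalar A})
    (phi1 : phi 1 = 1) (a b : A) (free_ab : freely_independent phi a b)
    (n : nat) (n_gt0 : (0 < n)%N) :
  kappa phi n (a * b + b * a) =
    \sum_(P in NC_connected_bipartite n)
      ((\prod_(V in even_blocks P) kappa phi #|V| a) *
         (\prod_(W in odd_blocks P) kappa phi #|W| b) +
       (\prod_(V in even_blocks P) kappa phi #|V| b) *
         (\prod_(W in odd_blocks P) kappa phi #|W| a)).
Proof.
have T0 : [set: 'I_n] != set0 by apply/set0Pn; exists (Ordinal n_gt0).
have := kappa_anticommutator_words phi1 free_ab T0.
rewrite cardsT card_ord => ->.
rewrite (eq_bigl predT) => [|E]; last by rewrite inE subsetT.
rewrite exchange_big preimsetT /=.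
rewrite (eq_bigl (fun P => (P \in NC (2 * n)) && graph_connected P)); last first.
  move=> P; apply: andb_id2l; rewrite inE => /andP[pP _].
  exact: linked_graph_connected.
under [RHS]eq_bigl do rewrite inE andbA.
rewrite [RHS]big_mkcondr /=; apply: eq_bigr => P /andP[].
rewrite inE => /andP[pP _] connP; exact: sum_word_colorings.
Qed.
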